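(* Let $E$ be a (real) Banach space, let $X:=[B_{E^*},w^*]$ be the closed unit ball of $E^*$ with the weak* topology, let $Y:=\mathbb{R}$, and let $A:=\{G\lceil X : G\in B_{E^{**}}\}$ be the set of restrictions to $X$ of elements of the closed unit ball of $E^{**}$, equipped with the topology of pointwise convergence on $X$. The following statements are equivalent: (a) $E^*$ is (norm) separable. (b) $A$ is metrizable. (c) Every singleton of $A$ is a $G_\delta$ subset of $A$. (d) $A$ is uniformly recoverable.
   Context: A basis $(W_m)_{m\in\omega}$ for the topology of $X$ is a good basis if for each open $U\subseteq X$ and each $x\in U$ there is $m_0$ such that for all $m\geq m_0$: if $x\in W_m$ then $W_m\subseteq U$. Every separable metrizable space has a good basis. Given a good basis $(W_m)$ of $X$ (fixed), a dense sequence $D=(x_p)_{p\in\omega}$ in $X$ and $x\in X$, define: $s_0[x,D]:=x_0$; $s_{n+1}[x,D]:=s_n[x,D]$ if $x=s_n[x,D]$; otherwise $s_{n+1}[x,D]:=x_p$, where $p$ is least such that there exists $m$ with $\{x,x_p\}\subseteq W_m\subseteq X\setminus\{s_0[x,D],\ldots,s_n[x,D]\}$. $f:X\to Y$ is recoverable with respect to $D$ if $f(s_n[x,D])\to f(x)$ for each $x\in X$. $A$ is uniformly recoverable if there is a dense sequence $D$ of $X$ such that every $f\in A$ is recoverable with respect to $D$. If $X$ has no good basis (as happens when $X$ is not second countable), $A$ is not uniformly recoverable. *)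

(* Defs.v *)
From HB Require Import structures.
From mathcomp Require Import all_boot all_order all_algebra.
From mathcomp Require Import all_classical all_reals all_analysis.

Set Implicit Arguments.
Unset Strict Implicit.
Unset Printing Implicit Defensive.

Import Order.TTheory GRing.Theory Num.Theory.
Import numFieldNormedType.Exports.

Local Open Scope classical_set_scope.
Local Open Scope ring_scope.

Section Dual.
Context (R : realType) (E : normedModType R).

Definition clin : {pred E -> R} := mem [set f : E -> R | scalar f /\ continuous f].

Lemma clin_submod_closed : submod_closed clin.
Proof.
split.
  rewrite inE; split; last exact: cst_continuous.
  by move=> a x y /=; rewrite mulr0 addr0.
move=> a f g /[!inE] -[lf cf] [lg cg]; split.
  move=> b x y /=; rewrite !fctE/= lf lg.
  by rewrite scalerDr addrACA mulrDr /GRing.scale/= mulrCA.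
move=> x; apply: continuousD; last exact: cg.
by apply: continuousM; [exact: cst_continuous | exact: cf].
Qed.

HB.instance Definition _ :=
  GRing.isSubmodClosed.Build R (E -> R) clin clin_submod_closed.

Record dual := Dual { dual_fun :> E -> R ; dual_funP : dual_fun \in clin }.

HB.instance Definition _ := [isSub for dual_fun].
HB.instance Definition _ := [Choice of dual by <:].
HB.instance Definition _ := [SubChoice_isSubLmodule of dual by <:].

Definition dual_norm (f : dual) : R := sup [set `|f x| | x in [set x | `|x| <= 1]].

Implicit Types f g : dual.

Lemma dual_scalar f : scalar f.
Proof. by case: f => f /=; rewrite inE => -[]. Qed.

Lemma dual_continuous f : continuous f.
Proof. by case: f => f /=; rewrite inE => -[]. Qed.

Lemma dualD f x y : f (x + y) = f x + f y.
Proof. by have := dual_scalar f 1 x y; rewrite scale1r mul1r. Qed.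

Lemma dual0 f : f 0 = 0.
Proof. by apply: (addrI (f 0)); rewrite -dualD !addr0. Qed.

Lemma dualZ f a x : f (a *: x) = a * f x.
Proof. by have := dual_scalar f a x 0; rewrite dual0 !addr0. Qed.

Lemma dual_norm_bounded f : exists M, forall x, `|x| <= 1 -> `|f x| <= M.
Proof.
have lf : linear (f : E -> R^o) by exact: dual_scalar.
pose g : {linear E -> R^o} := HB.pack (f : E -> R^o)
  (GRing.isLinear.Build _ _ _ _ _ lf).
have /bounded_funP/(_ 1) // : bounded_near g (nbhs (0 : E)).
by apply/linear_bounded_continuous; exact: dual_continuous.
Qed.

Lemma dual_norm_has_sup f : has_sup [set `|f x| | x in [set x | `|x| <= 1]].
Proof.
split; first by exists `|f 0|, 0 => //=; rewrite normr0.
by have [M fM] := dual_norm_bounded f; exists M => _ [x /= x1 <-]; exact: fM.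
Qed.

Lemma dual_norm_ub f x : `|x| <= 1 -> `|f x| <= dual_norm f.
Proof. by move=> x1; apply: (sup_upper_bound (dual_norm_has_sup f)); exists x. Qed.

Lemma dual_norm_le f M : (forall x, `|x| <= 1 -> `|f x| <= M) -> dual_norm f <= M.
Proof.
move=> fM; apply: ge_sup; first by case: (dual_norm_has_sup f).
by move=> _ [x /= x1 <-]; exact: fM.
Qed.

Lemma dual_normD f g : dual_norm (f + g) <= dual_norm f + dual_norm g.
Proof.
apply: dual_norm_le => x x1; apply: (le_trans (ler_normD _ _)).
by apply: lerD; exact: dual_norm_ub.
Qed.

Lemma dual_normZ_le a f : dual_norm (a *: f) <= `|a| * dual_norm f.
Proof.
apply: dual_norm_le => x x1; rewrite [X in `|X|](_ : _ = a * f x)// normrM.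
by rewrite ler_wpM2l//; exact: dual_norm_ub.
Qed.

Lemma dual_normZ a f : dual_norm (a *: f) = `|a| * dual_norm f.
Proof.
apply/eqP; rewrite eq_le dual_normZ_le /=.
have [->|a0] := eqVneq a 0.
  rewrite normr0 mul0r; apply: (le_trans (normr_ge0 _)); apply: (@dual_norm_ub _ 0).
  by rewrite normr0.
rewrite -ler_pdivlMl ?normr_gt0// -normfV.
by rewrite -[in leLHS](scalerK a0 f); exact: dual_normZ_le.
Qed.

Lemma dual_norm0_eq0 f : dual_norm f = 0 -> f = 0.
Proof.
move=> f0; apply/val_inj/funext => x /=; rewrite [RHS](_ : _ = 0)//.
have [->|x0] := eqVneq x 0; first exact: dual0.
have nx0 : `|x| != 0 by rewrite normr_eq0.
apply: (mulfI (invr_neq0 nx0)); rewrite mulr0 -dualZ.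
apply/eqP; rewrite -normr_le0 -f0; apply: dual_norm_ub.
by rewrite normrZ normfV normr_id mulVf.
Qed.

HB.instance Definition _ :=
  Lmodule_isNormed.Build R dual dual_normD dual_normZ dual_norm0_eq0.

End Dual.

Definition weak_star (R : realType) (E : normedModType R) : Type :=
  initial_topology (fun f : dual E => dual_fun f : {ptws E -> R}).

HB.instance Definition _ (R : realType) (E : normedModType R) :=
  Topological.copy (weak_star E)
    (initial_topology (fun f : dual E => dual_fun f : {ptws E -> R})).

(* The ascription selects the operator norm on the carrier of [weak_star E];
   [dual_ball] is then read as a type through [set_type], which carries the
   subspace topology. *)
Definition dual_ball (R : realType) (E : normedModType R) : set (weak_star E) :=
  [set f | `|f : dual E| <= 1].
Arguments dual_ball {R} E.

Definition bidual_ball_restr (R : realType) (E : normedModType R) :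
    set {ptws dual_ball E -> R} :=
  [set g | exists2 G : dual (dual E),
     `|G| <= 1 & g = fun f : dual_ball E => G (set_val f : dual E)].
Arguments bidual_ball_restr {R} E.

Definition separable (T : topologicalType) :=
  exists2 D : set T, countable D & dense D.

Definition metrizable (R : realType) (T : topologicalType) :=
  exists d : T -> T -> R,
    [/\ forall x y, d x y = 0 <-> x = y,
        forall x y, d x y = d y x,
        forall x y z, d x z <= d x y + d y z &
        forall (x : T) (U : set T),
          nbhs x U <-> exists2 e, 0 < e & [set y | d x y < e] `<=` U].

Section Recovery.
Context (X : topologicalType).
Implicit Types (W : nat -> set X) (D : nat -> X) (x : X).

Definition good_basis W :=
  basis (range W) /\
  forall (U : set X) x, open U -> U x ->
    exists m0, forall m, (m0 <= m)%N -> W m x -> W m `<=` U.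

Definition least_nat (P : set nat) : nat :=
  get [set p | P p /\ forall q, P q -> (p <= q)%N].

Definition next_indices W D x (h : seq X) : set nat :=
  [set p | exists m, [set x; D p] `<=` W m /\ W m `<=` ~` [set` h]].

(* [history W D x n] is the list s_n, ..., s_0, most recent term first. If [X] is
   T1, [W] a basis and [D] dense, [next_indices] is nonempty whenever [x] is not
   in [h], so the default value of [get] is never reached. *)
Fixpoint history W D x (n : nat) : seq X :=
  if n is n'.+1 then
    let h := history W D x n' in
    let s := head (D 0%N) h in
    (if x == s then s else D (least_nat (next_indices W D x h))) :: h
  else [:: D 0%N].

Definition recovery_seq W D x (n : nat) : X := head (D 0%N) (history W D x n).

Definition recoverable (Y : topologicalType) W D (f : X -> Y) :=
  forall x, f (recovery_seq W D x n) @[n --> \oo] --> f x.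

(* [W] is the good basis fixed on [X]; when [X] has none, [good_basis W] fails
   and nothing is uniformly recoverable. *)
Definition uniformly_recoverable (Y : topologicalType) W (A : set (X -> Y)) :=
  good_basis W /\
  exists2 D : nat -> X, dense (range D) & forall f, A f -> recoverable W D f.

End Recovery.

(* Main.v *)
Require Import Defs.
From HB Require Import structures.
From mathcomp Require Import all_boot all_order all_algebra.
From mathcomp Require Import all_classical all_reals all_analysis.
From mathcomp Require Import borel_hierarchy lra.
Import Order.TTheory GRing.Theory Num.Theory.
Import numFieldNormedType.Exports.
Local Open Scope classical_set_scope.
Local Open Scope ring_scope.

(** By Hahn-Banach, [E^*] is separable as soon as countably many functionals
    [f_n] have the property that only the zero element of the bidual vanishes on
    all of them. If the zero function is a G_delta point of [A], countably many
    basic neighbourhoods isolate it, and the countably many points of the ball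
    they mention are such a family. If [A] is recoverable with respect to [D],
    then [D] is such a family, because [G (s_n[x, D])] tends to [G x] and every
    [s_n[x, D]] lies in [D].

    If [E^*] is separable, metrizability of [A] holds because its elements are
    1-Lipschitz. For recoverability, [D] is built so that [s_n[x, D] --> x] in
    norm. The norm topology is described by countably many weak-* lower
    semicontinuous ranks [l_k] with values in [nat], and it suffices that
    [l_k (s_n[x, D]) = l_k x] for large [n]. Now [s_{n+1}[x, D]] is the first
    point of [D] in some [W_m] containing [x], with [m --> oo], while the ranks of
    [x] are minimal over [W_m] for large [m]. So one enumerates [D] by blocks, the
    [n]-th of which visits any [W_m] for the first time at a point whose
    [(l_0, ..., l_(n-1))] is lexicographically minimal over [W_m]. *)

Set Implicit Arguments.
Unset Strict Implicit.
Unset Printing Implicit Defensive.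

(** * The Hahn-Banach theorem *)

Definition sublinear (R : realType) (V : lmodType R) (p : V -> R) :=
  (forall u v, p (u + v) <= p u + p v) /\
  (forall a v, 0 <= a -> p (a *: v) <= a * p v).

Section HahnBanach.
Context (R : realType) (V : lmodType R).
Implicit Types (p q : V -> R) (u v w : V).

Lemma sublinear0 p : sublinear p -> p 0 = 0.
Proof.
move=> [pD pZ]; have := pD 0 0; have := pZ 0 0 (lexx 0).
by rewrite scale0r mul0r addr0 => p0 pp; lra.
Qed.

Lemma sublinearZ p a v : sublinear p -> 0 <= a -> p (a *: v) = a * p v.
Proof.
move=> sp; rewrite le0r => /orP[/eqP->|a0].
  by rewrite scale0r mul0r sublinear0.
have [_ pZ] := sp; apply/eqP; rewrite eq_le (pZ _ _ (ltW a0))/=.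
have := pZ a^-1 (a *: v); rewrite invr_ge0 ltW// scalerK ?gt_eqF// => /(_ isT).
by rewrite ler_pdivlMl.
Qed.

Lemma sublinearN p v : sublinear p -> - p (- v) <= p v.
Proof.
by move=> sp; have := sp.1 v (- v); rewrite subrr sublinear0// => ?; lra.
Qed.

(* The least value at [v] allowed by sublinearity once the value at [- w] is
   lowered to [- p w]. *)
Definition slide p w v : R :=
  inf [set p (v + t *: w) - t * p w | t in [set t | 0 <= t]].

Section Slide.
Context (p : V -> R) (w : V) (sp : sublinear p).

Lemma slide_has_inf v :
  has_inf [set p (v + t *: w) - t * p w | t in [set t | 0 <= t]].
Proof.
split; first by exists (p (v + 0 *: w) - 0 * p w); exists 0 => /=.
exists (- p (- v)) => _ [t /= t0 <-].
rewrite -sublinearZ//; have := sp.1 (v + t *: w) (- v).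
by rewrite addrAC subrr add0r => ?; lra.
Qed.

Lemma slide_le v t : 0 <= t -> slide p w v <= p (v + t *: w) - t * p w.
Proof. by move=> t0; apply: (ge_inf (slide_has_inf v).2); exists t. Qed.

Lemma slide_ge v a : (forall t, 0 <= t -> a <= p (v + t *: w) - t * p w) ->
  a <= slide p w v.
Proof.
move=> h; apply: lb_le_inf; first exact: (slide_has_inf v).1.
by move=> _ [t /= t0 <-]; exact: h.
Qed.

Lemma slide_le_id v : slide p w v <= p v.
Proof.
by have := slide_le v (lexx 0); rewrite scale0r addr0 mul0r subr0.
Qed.

Lemma slideN : slide p w (- w) <= - p w.
Proof.
by have := slide_le (- w) ler01; rewrite scale1r addNr sublinear0// mul1r sub0r.
Qed.

(** Parameters [t] for [u] and [s] for [v] combine to the admissible parameter [s + t] for [u + v],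
    and [t] for [v] scales to [a * t]. *)
Lemma slide_sublinear : sublinear (slide p w).
Proof.
split=> [u v|a v a0].
  rewrite -lerBlDr; apply: slide_ge => t t0; rewrite lerBlDr -lerBlDl.
  apply: slide_ge => s s0; rewrite lerBlDr.
  apply: (le_trans (slide_le _ (addr_ge0 s0 t0))).
  rewrite [s + t]addrC scalerDl addrACA.
  by have := sp.1 (u + t *: w) (v + s *: w) => ?; lra.
have h t : 0 <= t -> slide p w (a *: v) <= a * (p (v + t *: w) - t * p w).
  move=> t0; apply: (le_trans (slide_le _ (mulr_ge0 a0 t0))).
  by rewrite -scalerA -scalerDr sublinearZ// mulrBr mulrA.
move: a0; rewrite le0r => /orP[/eqP a0|a0].
  by have := h 0 (lexx 0); rewrite a0 !mul0r.
rewrite -ler_pdivrMl//; apply: slide_ge => t t0.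
by rewrite ler_pdivrMl//; exact: h.
Qed.

End Slide.

(** Zorn's lemma for the reversed pointwise order. A chain is bounded by its pointwise infimum,
    which is finite because every member is at least [- p (- v)] at [v]. *)
Lemma minimal_sublinear p : sublinear p -> exists q, [/\ sublinear q,
  forall v, q v <= p v &
  forall r, sublinear r -> (forall v, r v <= q v) -> r = q].
Proof.
move=> sp.
pose T := {q : V -> R | sublinear q /\ forall v, q v <= p v}.
pose ge (s t : T) := `[< forall v, sval t v <= sval s v >].
have [||||[q [sq qp]] qmin] := @Zorn T ge.
- by move=> t; apply/asboolP.
- move=> r s t /asboolP rs /asboolP st; apply/asboolP => v.
  exact: le_trans (st v) (rs v).
- move=> [s s'] [t t'] /asboolP/= st /asboolP/= ts; apply/eq_exist/funext => v.
  by apply/eqP; rewrite eq_le st ts.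
- move=> A Atot; have [->|/set0P[t0 At0]] := eqVneq A set0.
    by exists (exist _ p (conj sp (fun=> lexx _))).
  pose Q v := [set sval t v | t in A].
  have Qinf v : has_inf (Q v).
    split; first by exists (sval t0 v); exists t0.
    exists (- p (- v)) => _ [[t [st tp]] At <-] /=.
    by apply: le_trans (sublinearN v st); rewrite lerN2.
  pose q v := inf (Q v).
  have qle t v : A t -> q v <= sval t v.
    by move=> At; apply: (ge_inf (Qinf v).2); exists t.
  have qge v a : (forall t, A t -> a <= sval t v) -> a <= q v.
    move=> h; apply: lb_le_inf; first exact: (Qinf v).1.
    by move=> _ [t At <-]; exact: h.
  have sq : sublinear q.
    split=> [u v|a v a0].
      rewrite -lerBlDr; apply: (qge _ _) => s As; rewrite lerBlDr -lerBlDl.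
      apply: (qge _ _) => t At; rewrite lerBlDr.
      (* Members of the chain are comparable, so the smaller one serves for both [u] and [v]. *)
      have [/asboolP st|/asboolP ts] := Atot s t As At.
        apply: (le_trans (qle t _ At)); apply: (le_trans ((proj2_sig t).1.1 _ _)).
        by rewrite addrC lerD2l.
      apply: (le_trans (qle s _ As)); apply: (le_trans ((proj2_sig s).1.1 _ _)).
      by rewrite addrC lerD2r.
    have h t : A t -> q (a *: v) <= a * sval t v.
      move=> At; apply: (le_trans (qle t _ At)).
      exact: (proj2_sig t).1.2.
    move: a0; rewrite le0r => /orP[/eqP a0|a0].
      by have := h t0 At0; rewrite a0 !mul0r.
    rewrite -ler_pdivrMl//; apply: (qge _ _) => t At.
    by rewrite ler_pdivrMl//; exact: h.
  have qp v : q v <= p v by apply: (le_trans (qle t0 v At0)); exact: (proj2_sig t0).2.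
  exists (exist _ q (conj sq qp)) => s As; apply/asboolP => v /=; exact: qle.
exists q; split=> // r sr rq.
have rp v : r v <= p v by exact: le_trans (rq v) (qp v).
have ge_qr : ge (exist _ q (conj sq qp)) (exist _ r (conj sr rp)).
  exact/asboolP.
by have := congr1 (@sval _ _) (qmin _ ge_qr).
Qed.

(** A minimal [F] below [slide p w] equals each of its own slides, so [F (- v) <= - F v]; with
    sublinearity this makes [F] odd, hence linear. The bound [slideN] at [- w] gives the value at
    [w]. *)
Theorem hahn_banach p w : sublinear p ->
  exists F : V -> R, [/\ scalar F, forall v, F v <= p v & F w = p w].
Proof.
move=> sp; have [F [sF Fp Fmin]] := minimal_sublinear (slide_sublinear w sp).
have FN v : F (- v) = - F v.
  have eF := Fmin _ (slide_sublinear v sF) (slide_le_id v sF).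
  have := slideN v sF; rewrite eF; have := sublinearN v sF => ? ?.
  by apply/eqP; rewrite eq_le; apply/andP; split; lra.
have FZ a v : F (a *: v) = a * F v.
  have [a0|a0] := leP 0 a; first exact: sublinearZ.
  by rewrite -[a]opprK scaleNr FN sublinearZ ?mulNr// oppr_ge0 ltW.
exists F; split=> [a u v|v|].
- apply/eqP; rewrite eq_le -FZ sF.1 /= -[leRHS]opprK lerNr -FN opprD.
  by rewrite (le_trans (sF.1 _ _))// !FN opprD.
- exact: le_trans (Fp v) (slide_le_id w sp v).
- apply/eqP; rewrite eq_le (le_trans (Fp w) (slide_le_id w sp w))/=.
  by rewrite -lerN2 -FN (le_trans (Fp _))// slideN.
Qed.

End HahnBanach.

(** * Separability of normed spaces *)

Section DualNorm.
Context (R : realType) (V : normedModType R).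
Implicit Types (f g : dual V) (v : V).

Lemma dualB f v w : f (v - w) = f v - f w.
Proof. by rewrite dualD -scaleN1r dualZ mulN1r. Qed.

Lemma dual_norm_bound f v : `|f v| <= `|f| * `|v|.
Proof.
have [->|v0] := eqVneq v 0; first by rewrite dual0 !normr0 mulr0.
rewrite -ler_pdivrMr ?normr_gt0// -[X in _ / X]normr_id -normfV -normrM mulrC.
rewrite -dualZ; apply: dual_norm_ub.
by rewrite normrZ normfV normr_id mulVf// normr_eq0.
Qed.

Lemma dual_norm_gt f r : r < `|f| -> exists2 v, `|v| <= 1 & r < `|f v|.
Proof.
move=> /(sup_gt (dual_norm_has_sup f).1)[_ [v v1 <-] rv].
by exists v.
Qed.

Lemma dual_of_bounded (F : V -> R) (C : R) : scalar F ->
  (forall v, `|F v| <= C * `|v|) -> exists f : dual V, dual_fun f = F.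
Proof.
move=> lF FC.
have lF' : linear (F : V -> R^o) by exact: lF.
pose G : {linear V -> R^o} := HB.pack (F : V -> R^o)
  (GRing.isLinear.Build _ _ _ _ _ lF').
have cF : continuous F.
  apply: (@linear_bounded_continuous _ _ _ G).1.
  apply/linear_boundedP; near=> M => v.
  by rewrite (le_trans (FC v))// ler_wpM2r//; near: M; exact: nbhs_pinfty_ge.
have FP : F \in @clin R V by rewrite inE.
by exists (Dual FP).
Unshelve. all: by end_near. Qed.

End DualNorm.

(** * Dense sequences and total sequences *)

Section Separable.
Context (R : realType) (V : normedModType R).

Lemma separable_seqP : separable V <-> exists u : nat -> V,
  forall v e, 0 < e -> exists n, `|v - u n| < e.
Proof.
split=> [[D /pfcard_geP[->|[u]] dD]|[u uP]].
- exfalso; have [|x [_ //]] := dD setT _ openT.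
  by exists 0.
- exists u => v e e0.
  have [||x [vx Dx]] := dD (ball v e).
  + by exists v; exact: ballxx.
  + exact: ball_open.
  have [n _ un] := 'surj_u Dx.
  by exists n; move: vx; rewrite -ball_normE /ball_/= un.
- exists (range u); first exact: card_image_le.
  move=> O [v Ov] oO.
  have /nbhs_ballP[e /= e0 veO] : nbhs v O by exact: open_nbhs_nbhs.
  have [n vn] := uP v e e0.
  by exists (u n); split; [apply: veO; rewrite -ball_normE | exists n].
Qed.

Lemma separable_ball : separable V -> exists u : nat -> V,
  (forall n, `|u n| <= 1) /\
  forall v e, `|v| <= 1 -> 0 < e -> exists n, `|v - u n| < e.
Proof.
move=> /separable_seqP[u uP].
pose w n := (Num.max 1 `|u n|)^-1 *: u n.
have m1 n : 0 < Num.max 1 `|u n| by rewrite lt_max ltr01.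
exists w; split=> [n|v e v1 e0].
  by rewrite normrZ normfV (gtr0_norm (m1 n)) ler_pdivrMl// mulr1 le_max lexx orbT.
have [n vn] := uP v (e / 2) (divr_gt0 e0 (ltr0n _ 2)).
exists n; rewrite -(subrK (u n) v) -addrA.
apply: (le_lt_trans (ler_normD _ _)).
(* Radial projection moves [u n] by the excess of its norm over 1, which is at most its distance to
   the point [v] of the ball. *)
suff : `|u n - w n| <= `|v - u n| by lra.
rewrite /w; have [un1|un1] := leP `|u n| 1; first by rewrite invr1 scale1r subrr normr0.
have un0 : 0 < `|u n| by lra.
rewrite -[X in X - _]scale1r -scalerBl normrZ ger0_norm; last first.
  by rewrite subr_ge0 invf_le1 // ltW.
rewrite mulrBl mul1r mulVf ?gt_eqF//.
have := lerB_dist (u n) v; rewrite distrC; lra.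
Qed.

Variable S : nat -> V.

(** The map [h] lets one sum serve for real coefficients ([id]) and for rational ones ([ratr]),
    whose lists are countable. *)
Let comb (K : pzRingType) (h : K -> R) (s : seq (K * nat)) : V :=
  \sum_(x <- s) h x.1 *: S x.2.

Let comb_ratr (s : seq (R * nat)) (e : R) : 0 < e ->
  exists t : seq (rat * nat), `|comb id s - comb (@ratr R) t| < e.
Proof.
elim: s e => [|[a n] s IH] e e0.
  by exists [::]; rewrite /comb !big_nil subrr normr0.
have e20 : 0 < e / 2 by lra.
have [t st] := IH _ e20.
have c0 : 0 < e / 2 / (`|S n| + 1) by rewrite divr_gt0// ltr_wpDl.
have [q] : exists q : rat, ratr q \in `]a, (a + e / 2 / (`|S n| + 1))[.
  by apply: rat_in_itvoo; rewrite ltrDl.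
rewrite in_itv/= => /andP[aq qa].
exists ((q, n) :: t); rewrite /comb !big_cons/= opprD addrACA -scalerBl.
apply: (le_lt_trans (ler_normD _ _)); rewrite normrZ distrC gtr0_norm ?subr_gt0//.
move: st; rewrite /comb => st.
suff : (ratr q - a) * `|S n| <= e / 2 by lra.
have : ratr q - a <= e / 2 / (`|S n| + 1) by lra.
rewrite ler_pdivlMr ?ltr_wpDl// mulrDr mulr1.
by have : 0 < ratr q - a; lra.
Qed.

(** Distance to the linear span of [S], used as the dominating functional in Hahn-Banach. *)
Let dist (v : V) : R := inf [set `|v - comb id s| | s in [set: seq (R * nat)]].

Let dist_has_inf v : has_inf [set `|v - comb id s| | s in [set: seq (R * nat)]].
Proof.
split; first by exists `|v - comb id [::]|, [::].
by exists 0 => _ [s _ <-].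
Qed.

Let dist_le v s : dist v <= `|v - comb id s|.
Proof. by apply: (ge_inf (dist_has_inf v).2); exists s. Qed.

Let dist_ge v a : (forall s, a <= `|v - comb id s|) -> a <= dist v.
Proof.
move=> h; apply: lb_le_inf; first exact: (dist_has_inf v).1.
by move=> _ [s _ <-]; exact: h.
Qed.

Let dist_sublinear : sublinear dist.
Proof.
split=> [u v|a v a0].
  rewrite -lerBlDr; apply: dist_ge => s; rewrite lerBlDr -lerBlDl.
  apply: dist_ge => t; rewrite lerBlDl.
  apply: (le_trans (dist_le _ (s ++ t))).
  rewrite /comb big_cat/= opprD addrACA; exact: ler_normD.
have h s : dist (a *: v) <= a * `|v - comb id s|.
  apply: (le_trans (dist_le _ [seq (a * x.1, x.2) | x <- s])).
  rewrite /comb big_map/= -[X in _ <= X * _](ger0_norm a0) -normrZ scalerBr scaler_sumr.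
  by under eq_bigr do rewrite -scalerA.
move: a0; rewrite le0r => /orP[/eqP a0|a0].
  by have := h [::]; rewrite a0 !mul0r.
rewrite -ler_pdivrMl//; apply: dist_ge => s.
by rewrite ler_pdivrMl//; exact: h.
Qed.

(** A point far from all rational combinations has positive distance to the span of [S]. Hahn-Banach
    gives a functional dominated by that distance, hence bounded and zero on [S], yet nonzero at the
    point. *)
Lemma total_separable :
  (forall f : dual V, (forall n, f (S n) = 0) -> f = 0) -> separable V.
Proof.
move=> Stot; apply/separable_seqP.
pose u n := if unpickle n is Some s then comb (@ratr R) s else 0.
exists u => v e e0; apply/not_existsP => far.
have vfar : e / 2 <= dist v.
  apply: dist_ge => s; rewrite leNgt; apply/negP => vs.
  have [t st] := comb_ratr s (divr_gt0 e0 (ltr0n R 2)).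
  apply: (far (pickle t)); rewrite /u pickleK.
  rewrite -(subrK (comb id s) v) -addrA.
  by apply: (le_lt_trans (ler_normD _ _)); lra.
have [F [lF Fle Fv]] := hahn_banach v dist_sublinear.
have FN w : F (- w) = - F w.
  have F0 : F 0 = 0 by have := lF 1 0 0; rewrite scale1r mul1r addr0; lra.
  by have := lF (-1) w 0; rewrite scaleN1r !addr0 F0 addr0 mulN1r.
have Fb w : `|F w| <= 1 * `|w|.
  have h z : F z <= `|z|.
    by apply: (le_trans (Fle z)); have := dist_le z [::]; rewrite /comb big_nil subr0.
  by rewrite mul1r ler_norml h andbT lerNl -FN -[leRHS]normrN h.
have [f fE] := dual_of_bounded lF Fb.
have f0 : f = 0.
  apply: Stot => n; rewrite fE.
  have h c : dist (c *: S n) <= 0.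
    by have := dist_le (c *: S n) [:: (c, n)]; rewrite /comb big_seq1 subrr normr0.
  have := Fle (S n); have := h 1; have := h (-1); have := Fle (- S n).
  rewrite scale1r scaleN1r FN => *.
  by apply/eqP; rewrite eq_le; apply/andP; split; lra.
have Fv0 : F v = 0 by rewrite -fE f0.
by move: vfar; rewrite -Fv Fv0; lra.
Qed.

End Separable.

(** * Recovery from lower semicontinuous ranks *)

Section RankRecovery.
Context (X : topologicalType) (W : nat -> set X) (l : nat -> X -> nat).
Hypothesis Wgood : good_basis W.
Hypothesis XT1 : accessible_space X.
Hypothesis l_lsc : forall k x, \forall y \near x, (l k x <= l k y)%N.

Implicit Types (x y z : X) (s t : seq X) (m n p : nat).

(** * Lexicographic comparison of ranks *)

Definition lex_lt n x y := exists2 k, (k < n)%N &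
  (forall i, (i < k)%N -> l i x = l i y) /\ (l k x < l k y)%N.

Lemma lex_ltW n n' x y : (n <= n')%N -> lex_lt n x y -> lex_lt n' x y.
Proof. by move=> nn' [k kn h]; exists k => //; exact: leq_trans nn'. Qed.

Lemma lex_lt_eql n x y z : (forall i, (i < n)%N -> l i y = l i z) ->
  lex_lt n x y -> lex_lt n x z.
Proof.
move=> yz [k kn [xy kxy]]; exists k => //; rewrite -yz//; split=> // i ik.
by rewrite xy// yz// (ltn_trans ik).
Qed.

(** Induction on [n], then on the class of the first [n] ranks, then on the value of the last rank
    among points sharing those [n] ranks. *)
Lemma lex_lt_wf n : well_founded (lex_lt n).
Proof.
elim: n => [|n IH] y; first by constructor=> z [].
suff: forall y', (forall i, (i < n)%N -> l i y' = l i y) -> Acc (lex_lt n.+1) y'.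
  by move=> accP; apply: (accP y) => i _.
elim: (IH y) => {}y _ IHy y'.
have [N] := ubnP (l n y'); elim: N y' => [|N IHN] y'; first by rewrite ltn0.
rewrite ltnS => y'N y'y; constructor=> z [k]; rewrite ltnS leq_eqVlt.
case/orP=> [/eqP->|kn] [zy' zky'].
  by apply: IHN => [|i i_n]; [exact: leq_trans zky' y'N|rewrite zy'// y'y].
apply: (IHy z) => //; apply: (lex_lt_eql y'y).
by exists k.
Qed.

Definition lex_minimal n m y := forall z, W m z -> ~ lex_lt n z y.

Lemma lex_minimalW n n' m y :
  (n <= n')%N -> lex_minimal n' m y -> lex_minimal n m y.
Proof. by move=> nn' h z /h + /(lex_ltW nn'). Qed.

Lemma good_basis_nbhs x (U : set X) : nbhs x U ->
  exists m0, forall m, (m0 <= m)%N -> W m x -> W m `<=` U.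
Proof.
move=> xU; have [m0 m0P] := Wgood.2 _ _ (open_interior U) xU.
by exists m0 => m mm Wx; apply: subset_trans (m0P m mm Wx) (@interior_subset _ _).
Qed.

Lemma ranks_ge_eventually n x : exists m0, forall m, (m0 <= m)%N -> W m x ->
  forall y, W m y -> forall k, (k < n)%N -> (l k x <= l k y)%N.
Proof.
have : \forall y \near x, forall k, (k < n)%N -> (l k x <= l k y)%N.
  elim: n => [|n IH]; first by near=> y.
  near=> y => k; rewrite ltnS leq_eqVlt => /orP[/eqP->|].
    by near: y; exact: l_lsc.
  by move: k; near: y.
move=> /good_basis_nbhs[m0 m0P]; exists m0 => m mm Wx y Wy.
exact: m0P Wy.
Unshelve. all: by end_near. Qed.

Lemma lex_minimal_eventually n x : exists m0, forall m, (m0 <= m)%N -> W m x ->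
  lex_minimal n m x.
Proof.
have [m0 m0P] := ranks_ge_eventually n x; exists m0 => m mm Wx z Wz [k kn [_]].
by rewrite ltnNge (m0P m).
Qed.

(** For large [m] each of the first [n] ranks attains its minimum over [W m] at [x], so at the first
    disagreement [x] would be lexicographically below [y]. *)
Lemma ranks_eq_eventually n x : exists m0, forall m, (m0 <= m)%N -> W m x ->
  forall y, W m y -> lex_minimal n m y -> forall k, (k < n)%N -> l k y = l k x.
Proof.
have [m0 m0P] := ranks_ge_eventually n x; exists m0 => m mm Wx y Wy ymin k.
elim/ltn_ind: k => k IH kn; apply/eqP; rewrite eqn_leq (m0P m)// andbT leqNgt.
apply/negP => xy; apply: (ymin x Wx); exists k => //; split=> // i ik.
by rewrite IH// (ltn_trans ik).
Qed.

(** * Lists whose first visits are minimal *)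

Fixpoint first_hit m s y : Prop :=
  if s is z :: s' then (W m z /\ y = z) \/ (~ W m z /\ first_hit m s' y)
  else False.

Lemma first_hit_cat m s t y : first_hit m (s ++ t) y ->
  first_hit m s y \/ (forall z, z \in s -> ~ W m z) /\ first_hit m t y.
Proof.
elim: s => [|u s IH]/=; first by right.
move=> [|[Wu /IH[|[sW ty]]]]; [by left; left|by left; right|right].
by split=> // z; rewrite inE => /orP[/eqP->//|]; exact: sW.
Qed.

Lemma first_hit_nth x0 m s i : (i < size s)%N -> W m (nth x0 s i) ->
  (forall j, (j < i)%N -> ~ W m (nth x0 s j)) -> first_hit m s (nth x0 s i).
Proof.
elim: s i => // z s IH [|i]/= => [_ Wz _|si Wi Wj]; first by left.
right; split; first exact: (Wj 0%N).
by apply: IH => // j ji; exact: (Wj j.+1).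
Qed.

(** Not a well-ordering in the usual sense, but the invariant of the blocks, chosen because it
    passes to concatenations. *)
Definition well_ordered n s := forall m y, first_hit m s y -> lex_minimal n m y.

Lemma well_ordered_cat n s t :
  well_ordered n s -> well_ordered n t -> well_ordered n (s ++ t).
Proof. by move=> hs ht m y /first_hit_cat[/hs//|[_ /ht]]. Qed.

(* Only finitely many [W m] contain [y] without [y] being minimal in them, so it
   suffices to list smaller points of these sets before [y]. *)
Lemma well_ordered_exists n y : exists2 s, well_ordered n s & y \in s.
Proof.
elim: (lex_lt_wf n y) => {}y _ IH.
have [m0 m0P] := lex_minimal_eventually n y.
have [s hs sP] : exists2 s, well_ordered n s & forall m, (m < m0)%N ->
    W m y -> ~ lex_minimal n m y -> exists2 z, z \in s & W m z.
  elim: m0 {m0P} => [|M [s hs sP]]; first by exists [::].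
  have [[WM /existsNP[z /not_implyP[Wz /contrapT zy]]]|nM] :=
      pselect (W M y /\ ~ lex_minimal n M y).
    have [t ht zt] := IH z zy; exists (s ++ t); first exact: well_ordered_cat.
    move=> m; rewrite ltnS leq_eqVlt => /orP[/eqP->|mM Wm nm].
      by exists z => //; rewrite mem_cat zt orbT.
    by have [u us Wu] := sP m mM Wm nm; exists u => //; rewrite mem_cat us.
  exists s => // m; rewrite ltnS leq_eqVlt => /orP[/eqP-> WM nm|]; last exact: sP.
  by exfalso; exact: nM.
exists (s ++ [:: y]); last by rewrite mem_cat mem_head orbT.
move=> m z /first_hit_cat[/hs//|[sW [[Wy ->{z}]|[_ []]]]].
apply: contrapT => ny; have [mm0|/m0P/(_ Wy)//] := ltnP m m0.
by have [z /sW] := sP m mm0 Wy ny.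
Qed.

(** * Concatenation of the blocks into one sequence *)

Context (x0 : X) (L : nat -> seq X).
Hypothesis L_ordered : forall n, well_ordered n (L n).
Hypothesis L_neq0 : forall n, (0 < size (L n))%N.

Fixpoint blocks n : seq X := if n is n'.+1 then blocks n' ++ L n' else [::].

Lemma size_blocks n : (n <= size (blocks n))%N.
Proof. by elim: n => //= n IH; rewrite size_cat -addn1 leq_add. Qed.

(** Blocks after the [n]-th satisfy the invariant for larger rank counts, and minimality for more
    ranks implies minimality for fewer. *)
Lemma blocks_add n d :
  exists2 s, blocks (n + d) = blocks n ++ s & well_ordered n s.
Proof.
elim: d => [|d [s es hs]]; first by exists [::]; rewrite ?addn0 ?cats0// => ? ? [].
exists (s ++ L (n + d)); first by rewrite addnS/= es catA.
apply: well_ordered_cat => // m y /L_ordered.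
by apply: lex_minimalW; exact: leq_addr.
Qed.

(** No block is empty, so [blocks p.+1] has more than [p] entries and the default [x0] is never
    read. *)
Definition concat p := nth x0 (blocks p.+1) p.

Lemma concatE n p : (p < size (blocks n))%N -> concat p = nth x0 (blocks n) p.
Proof.
move=> pn; rewrite /concat.
have [le|/ltnW le] := leqP n p.+1.
  have [s es _] := blocks_add n (p.+1 - n).
  by rewrite -(subnKC le) es nth_cat pn.
have [s es _] := blocks_add p.+1 (n - p.+1).
by rewrite -(subnKC le) es nth_cat size_blocks.
Qed.

(** A first visit to [W m] occurring after [blocks n] is also the first hit of the remaining tail,
    which satisfies the invariant for [n]. *)
Lemma concat_minimal n m p : (size (blocks n) <= p)%N -> W m (concat p) ->
  (forall q, (q < p)%N -> ~ W m (concat q)) -> lex_minimal n m (concat p).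
Proof.
move=> np; have [s es hs] := blocks_add n p.+1.
have sz : (p < size (blocks (n + p.+1)))%N.
  by rewrite (leq_trans _ (size_blocks _))// leq_addl.
have cE i : (i <= p - size (blocks n))%N -> concat (size (blocks n) + i) = nth x0 s i.
  move=> ip; rewrite (@concatE (n + p.+1)); last first.
    by apply: leq_ltn_trans sz; rewrite -(subnKC np) leq_add2l.
  by rewrite es nth_cat ltnNge leq_addr addKn.
rewrite -{1 3}(subnKC np) cE// => Wp Wq; apply: hs; apply: first_hit_nth => //.
  by rewrite ltn_subLR// -size_cat -es.
move=> j jp; rewrite -cE ?(ltnW jp)//; apply: Wq.
by rewrite -(subnKC np) ltn_add2l.
Qed.

(** * The recovery sequence along the concatenation *)

Hypothesis concat_dense : dense (range concat).

Let r x := recovery_seq W concat x.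
Let h x := history W concat x.

Lemma history_head x n : h x n = r x n :: behead (h x n).
Proof. by rewrite /r /h /recovery_seq; case: n. Qed.

Lemma history_mem x i n : (i <= n)%N -> r x i \in h x n.
Proof.
elim: n => [|n IH]; first by rewrite leqn0 => /eqP->; rewrite history_head mem_head.
rewrite leq_eqVlt => /orP[/eqP->|]; first by rewrite history_head mem_head.
by rewrite ltnS => /IH; rewrite /h /= inE => ->; rewrite orbT.
Qed.

Lemma history_memP x n z : z \in h x n -> exists2 i, (i <= n)%N & z = r x i.
Proof.
elim: n => [|n IH]; first by rewrite mem_seq1 => /eqP->; exists 0%N.
rewrite history_head inE => /orP[/eqP->|]; first by exists n.+1.
by move=> /IH[i i_n ->]; exists i => //; exact: leqW.
Qed.

Lemma recovery_stationary x i n : (i <= n)%N -> r x i = x -> r x n = x.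
Proof.
move=> + rix; elim: n => [|n IH]; first by rewrite leqn0 => /eqP<-.
rewrite leq_eqVlt => /orP[/eqP<-//|]; rewrite ltnS => /IH.
by rewrite /r /recovery_seq /= => ->; rewrite eqxx.
Qed.

Lemma least_natP (P : set nat) : P !=set0 ->
  P (least_nat P) /\ forall q, P q -> (least_nat P <= q)%N.
Proof.
move=> [p Pp]; rewrite /least_nat.
have /getPex // : exists q, [set q | P q /\ forall q', P q' -> (q <= q')%N] q.
have exP : exists q, `[< P q >] by exists p; exact/asboolP.
case: (ex_minnP exP) => q /asboolP Pq qmin; exists q; split=> // q' Pq'.
by apply: qmin; exact/asboolP.
Qed.

(** The history is finite and misses [x], so by T1 some [W m] contains [x] and avoids it; density
    makes the candidate set nonempty. With [m] a witness for the least index [p], an earlier point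
    in [W m] would be a smaller candidate. *)
Lemma recovery_step x n : (forall i, r x i <> x) ->
  exists p m, [/\ r x n.+1 = concat p, W m x, W m (concat p),
    (forall q, (q < p)%N -> ~ W m (concat q)) &
    forall i, (i <= n)%N -> ~ W m (r x i)].
Proof.
move=> rx; pose P := next_indices W concat x (h x n).
have ex : r x n.+1 = concat (least_nat P).
  rewrite {1}/r /recovery_seq/= -/(recovery_seq W concat x n) -/(r x n).
  by case: eqVneq => // xr; case: (rx n).
have P0 : P !=set0.
  have oC : open (~` [set` h x n]).
    apply: closed_openC; apply: (accessible_finite_set_closed.1 XT1).
    exact: finite_seq.
  have xC : (~` [set` h x n]) x.
    by move=> /= /history_memP[i _ xi]; apply: (rx i).
  have [_ [[m _ <-] Wx] WC] := Wgood.1.2 x _ (open_nbhs_nbhs (conj oC xC)).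
  have oW : open (W m) by apply: Wgood.1.1; exists m.
  have [y [Wy [p _ py]]] := concat_dense (ex_intro _ x Wx) oW.
  by exists p, m; split=> // z [->//|->]; rewrite py.
have [[m [Wm WC]] pmin] := least_natP P0.
exists (least_nat P), m; split=> //; [by apply: Wm; left|by apply: Wm; right| |].
- move=> q qp Wq; move: qp; rewrite ltnNge => /negP; apply; apply: pmin.
  by exists m; split=> // z [->|->//]; apply: Wm; left.
- by move=> i i_n /WC; apply; exact: history_mem.
Qed.

Lemma injective_nat_infty (f : nat -> nat) M : injective f ->
  exists N, forall n, (N <= n)%N -> (M <= f n)%N.
Proof.
move=> finj; elim: M => [|M [N NP]]; first by exists 0%N.
have [[n0 Nn0 e0]|no] := pselect (exists2 n, (N <= n)%N & f n = M).
  exists n0.+1 => n nn; rewrite ltn_neqAle NP ?(leq_trans Nn0 (ltnW nn))// andbT.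
  by apply/eqP => e; move: nn; rewrite (finj n0 n) ?ltnn// e0.
exists N => n Nn; rewrite ltn_neqAle NP// andbT; apply/eqP => e.
by apply: no; exists n.
Qed.

Lemma concat_recovery x k : \forall n \near \oo, l k (r x n) = l k x.
Proof.
have [[i rix]|/forallNP rx] := pselect (exists i, r x i = x).
  by exists i => // n /= i_n; rewrite (recovery_stationary i_n rix).
have /choice[p /choice[m pmP]] := fun n => recovery_step n rx.
(* [W (m b)] avoids all terms up to index [b], whereas [W (m a)] contains the term of index [a.+1].
   Distinctness then forces [m n] to infinity. *)
have minj : injective m.
  have mlt a b : (a < b)%N -> m a <> m b.
    move=> ab e; have [_ _ _ _ /(_ a.+1 ab)] := pmP b.
    by apply; rewrite -e; have [-> _ ? _ _] := pmP a.
  by move=> a b e; case: (ltngtP a b) => // /mlt; [move/(_ e)|move/(_ (esym e))].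
have [m1 m1P] := ranks_eq_eventually k.+1 x.
(* Only finitely many points lie in [blocks k.+1], so small basic sets around [x] exclude those
   different from [x]. *)
have [m2 m2P] : exists m2, forall m, (m2 <= m)%N -> W m x ->
    W m `<=` [set y | y \in blocks k.+1 -> y = x].
  apply: good_basis_nbhs.
  pose F := [set y | y \in blocks k.+1 /\ y <> x].
  have oF : open (~` F).
    apply: closed_openC; apply: (accessible_finite_set_closed.1 XT1).
    apply: (@sub_finite_set _ _ [set` blocks k.+1]); last exact: finite_seq.
    by move=> y [].
  have Fx : (~` F) x by case.
  apply: filterS (open_nbhs_nbhs (conj oF Fx)) => y Fy yp.
  by apply: contrapT => yx; exact: Fy.
have [N NP] := injective_nat_infty (maxn m1 m2) minj.
exists N.+1 => // -[//|n] /=; rewrite ltnS => /NP; rewrite geq_max => /andP[nm1 nm2].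
have [-> Wx Wp Wq _] := pmP n.
apply: (m1P (m n)) => //; apply: concat_minimal => //.
(* A term taken from [blocks k.+1] would have to be [x], which is never reached in this case. *)
rewrite leqNgt; apply/negP => pk; apply: (rx n.+1).
have [-> _ _ _ _] := pmP n; apply: (m2P (m n)) => //.
by rewrite (concatE pk) mem_nth.
Qed.

End RankRecovery.

(** The [n]-th block is chosen to contain a point of [W n] whenever [W n] is nonempty, which makes
    the concatenation dense. *)
Theorem rank_recovery (X : topologicalType) (W : nat -> set X)
    (l : nat -> X -> nat) (x0 : X) : good_basis W -> accessible_space X ->
    (forall k x, \forall y \near x, (l k x <= l k y)%N) ->
  exists2 D : nat -> X, dense (range D) &
    forall x k, \forall n \near \oo, l k (recovery_seq W D x n) = l k x.
Proof.
move=> Wgood XT1 l_lsc.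
have /choice[y yP] : forall i, exists y, W i !=set0 -> W i y.
  move=> i; have [[y Wy]|W0] := pselect (W i !=set0); first by exists y.
  by exists x0.
have /choice[L LP] : forall n, exists s, well_ordered W l n s /\ y n \in s.
  by move=> n; have [s] := well_ordered_exists Wgood l_lsc n (y n); exists s.
have L0 n : (0 < size (L n))%N by have [_] := LP n; case: (L n).
have dD : dense (range (concat x0 L)).
  move=> O [x Ox] oO.
  have [_ [[m _ <-] Wx] WO] := Wgood.1.2 x _ (open_nbhs_nbhs (conj oO Ox)).
  exists (y m); split; first by apply: WO; apply: yP; exists x.
  have yL : y m \in blocks L m.+1 by rewrite /= mem_cat (LP m).2 orbT.
  exists (index (y m) (blocks L m.+1)) => //.
  by rewrite (concatE x0 (fun n => (LP n).1) L0 (n := m.+1)) ?index_mem// nth_index.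
exists (concat x0 L) => // x k.
exact: (concat_recovery Wgood XT1 l_lsc (fun n => (LP n).1) L0 dD).
Qed.

(** * The dual ball and the bidual ball *)

Section InitialTopologies.

Lemma initial_nbhs (S : choiceType) (T : topologicalType) (f : S -> T)
    (x : initial_topology f) (U : set (initial_topology f)) :
  nbhs x U -> exists2 B, nbhs (f x) B & f @^-1` B `<=` U.
Proof.
rewrite nbhsE => -[? [[B oB <-] Bx] BU]; exists B => //.
by exists B.
Qed.

(** It suffices that the filter generated by these sets converges to [g]; the product topology being
    a supremum, this is tested one coordinate at a time. *)
Lemma ptws_nbhs (R : realType) (I : choiceType) (g : {ptws I -> R})
    (U : set {ptws I -> R}) : nbhs g U ->
  exists s : seq I, exists2 e, 0 < e &
    forall h : {ptws I -> R}, (forall i, i \in s -> `|g i - h i| < e) -> U h.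
Proof.
pose F : set_system (I -> R) := filter_from [set x : seq I * R | 0 < x.2]
  (fun x => [set h | forall i, i \in x.1 -> `|g i - h i| < x.2]).
have FF : Filter F.
  apply: filter_from_filter; first by exists ([::], 1) => /=.
  move=> [s e] [t d] /= e0 d0; exists (s ++ t, Num.min e d).
    by rewrite /= lt_min e0.
  move=> h /= hst; split=> i si.
    by have := hst i; rewrite mem_cat si lt_min => /(_ isT) /andP[].
  by have := hst i; rewrite mem_cat si orbT lt_min => /(_ isT) /andP[].
suff Fg : F --> g by move=> /Fg[[s e] e0 seU]; exists s, e.
apply/cvg_sup => i A /initial_nbhs[B /nbhs_ballP[e /= e0 gB] BA].
exists ([:: i], e) => //= h /(_ i); rewrite mem_head => /(_ isT) hi.
by apply: BA; apply: gB; rewrite -ball_normE.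
Qed.

Lemma subtype_nbhs (T : topologicalType) (A : set T) (x : A) (U : set A) :
  nbhs x U -> exists2 B, nbhs (set_val x) B & set_val @^-1` B `<=` U.
Proof. exact: initial_nbhs. Qed.

End InitialTopologies.

(** * The dual ball with its weak-* topology *)

Section DualBall.
Context (R : realType) (E : normedModType R).
Implicit Types (f : dual_ball E) (v : E).

(** Typed in [dual E] rather than [weak_star E], so that the operator norm applies. *)
Definition ball_fun f : dual E := set_val f.

Lemma ball_fun_norm f : `|ball_fun f| <= 1.
Proof. exact: (set_valP f). Qed.

Lemma ball_fun_inj : injective ball_fun.
Proof. by move=> f g; exact: val_inj. Qed.

Lemma ball_funP (f : dual E) : `|f| <= 1 -> exists g, ball_fun g = f.
Proof.
move=> f1; have f1' : (f : weak_star E) \in dual_ball E by rewrite inE.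
by exists (SigSub f1').
Qed.

Lemma ball_fun_le f v : `|ball_fun f v| <= `|v|.
Proof.
apply: (le_trans (dual_norm_bound _ _)).
by rewrite ler_piMl// ball_fun_norm.
Qed.

Lemma ball_eval_continuous v : continuous (fun f => ball_fun f v).
Proof.
move=> f; apply: (@continuous_comp _ {ptws E -> R} _
  (fun f => dual_fun (ball_fun f) : {ptws E -> R}) (fun g => g v)).
  apply: (@continuous_comp _ (weak_star E) {ptws E -> R} set_val
    (fun f : weak_star E => dual_fun f : {ptws E -> R})).
    exact: initial_continuous.
  exact: initial_continuous.
exact: proj_continuous.
Qed.

Lemma ball_dist_continuous v (a : R) :
  continuous (fun f => `|ball_fun f v - a|).
Proof.
move=> f; apply: (@continuous_comp _ R^o R^o (fun h => ball_fun h v) (fun t => `|t - a|)).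
  exact: ball_eval_continuous.
apply: (@cvg_norm _ R^o); apply: (@cvgB _ R^o); [exact: cvg_id | exact: cvg_cst].
Qed.

Lemma ball_nbhs f (U : set (dual_ball E)) : nbhs f U ->
  exists s : seq E, exists2 e, 0 < e &
    forall h, (forall v, v \in s -> `|ball_fun f v - ball_fun h v| < e) -> U h.
Proof.
move=> /subtype_nbhs[B /initial_nbhs[B' /ptws_nbhs[s [e e0 sB']] B'B] BU].
exists s, e => // h hs; apply: BU; apply: B'B; exact: sB'.
Qed.

Lemma ball_accessible : accessible_space (dual_ball E).
Proof.
move=> f g /eqP fg.
have [v fgv] : exists v, ball_fun f v <> ball_fun g v.
  apply/existsNP => e; apply: fg; apply: ball_fun_inj; apply: val_inj.
  exact/funext.
exists [set h | ball_fun h v != ball_fun g v]; split.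
- apply: (@open_comp _ _ (fun h => ball_fun h v) [set t | t != ball_fun g v]).
    by move=> h _; exact: ball_eval_continuous.
  exact: open_neq.
- by rewrite inE /=; exact/eqP.
- by rewrite inE /= eqxx.
Qed.

(** The norm is a supremum of evaluations: one vector [v] of the unit ball witnesses the strict
    bound, and evaluation at [v] is weak-* continuous. *)
Lemma ball_norm_lsc f (c : dual E) r : r < `|ball_fun f - c| ->
  \forall h \near f, r < `|ball_fun h - c|.
Proof.
move=> /dual_norm_gt[v v1 rv].
apply: filterS (cvgr_gt _ (@ball_dist_continuous v (c v) f) _ rv) => h; move=> /lt_le_trans; apply.
apply: (le_trans (dual_norm_bound (ball_fun h - c) v)).
by rewrite ler_piMr.
Qed.

(** * A good basis of the dual ball *)

Context (u : nat -> E).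
Hypothesis u1 : forall n, `|u n| <= 1.
Hypothesis u_dense : forall v (e : R), `|v| <= 1 -> 0 < e -> exists n, `|v - u n| < e.

(* The values at [u i] lie in [-1, 1]; box centers run over the grid of mesh
   [1 / (k + 1)]. *)
Definition box k (a : {ffun 'I_k -> 'I_(k.*2.+3)}) : set (dual_ball E) :=
  [set f | forall i : 'I_k, `|ball_fun f (u i) - ((a i)%:R / k.+1%:R - 1)| < k.+1%:R^-1].

Lemma box_cover k f : exists a, box (k := k) a f.
Proof.
have k0 : 0 < k.+1%:R :> R by [].
have /choice[a aP] : forall i : 'I_k, exists a : 'I_(k.*2.+3),
    `|ball_fun f (u i) - (a%:R / k.+1%:R - 1)| < k.+1%:R^-1.
  (* The value is rescaled to [t] in [[0, 2 * (k + 1)]]; rounding down gives a grid index of at most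
     [2 * k + 2]. *)
  move=> i; pose t := (ball_fun f (u i) + 1) * k.+1%:R.
  have := ball_fun_le f (u i) => /le_trans/(_ (u1 i)); rewrite ler_norml => /andP[f1 f2].
  have t0 : 0 <= t by rewrite mulr_ge0// -lerBlDr sub0r.
  have /andP[ta at1] := truncn_itv t0.
  have at2 : (Num.truncn t < k.*2.+3)%N.
    rewrite -(ltr_nat R); apply: (le_lt_trans ta).
    apply: (@le_lt_trans _ _ (2 * k.+1%:R)); first by rewrite ler_wpM2r//; lra.
    by rewrite -natrM ltr_nat mul2n doubleS.
  exists (Ordinal at2) => /=.
  set q : R := (Num.truncn t)%:R.
  have -> : ball_fun f (u i) - (q / k.+1%:R - 1) = (t - q) / k.+1%:R.
    by rewrite /t mulrBl mulfK ?gt_eqF// opprB addrA.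
  rewrite normrM normfV (gtr0_norm k0) ger0_norm ?subr_ge0//.
  by rewrite ltr_pdivrMr// mulVf ?gt_eqF// ltrBlDl /q natr1.
by exists [ffun i => a i] => i; rewrite ffunE.
Qed.

Lemma box_open k a : open (box (k := k) a).
Proof.
rewrite openE => f fa.
have : \forall h \near f, forall i : 'I_k,
    `|ball_fun h (u i) - ((a i)%:R / k.+1%:R - 1)| < k.+1%:R^-1; last by [].
apply: (filter_forall (nbhs_filter f)) => i.
exact: (cvgr_lt _ (@ball_dist_continuous _ _ f) _ (fa i)).
Qed.

Lemma box_small v (e : R) : 0 < e -> exists k0, forall k, (k0 <= k)%N ->
  forall a f h, box (k := k) a f -> box a h -> `|ball_fun f v - ball_fun h v| < e.
Proof.
move=> e0; pose c := `|v| + 1.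
have c0 : 0 < c by rewrite ltr_wpDl.
have w1 : `|c^-1 *: v| <= 1.
  by rewrite normrZ normfV (gtr0_norm c0) ler_pdivrMl// mulr1 lerDl.
(* Four errors add up: replacing the rescaled [v] by [u n] for [f] and for [h], and the distance of
   each to the box center. *)
have ec0 : 0 < e / c / 4 by rewrite !divr_gt0.
have [n wn] := u_dense w1 ec0.
have [k1 k1P] := ltr_add_invr ec0; rewrite add0r in k1P.
(* From [n.+1] on, [u n] is among the coordinates constrained by the box. *)
exists (maxn n.+1 k1) => k; rewrite geq_max => /andP[nk k1k] a f h fa ha.
have vE g : ball_fun g v = c * ball_fun g (c^-1 *: v).
  by rewrite dualZ mulrA mulfV ?mul1r// gt_eqF.
rewrite !vE -mulrBr normrM (gtr0_norm c0) mulrC -ltr_pdivlMr//.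
have kk1 : k.+1%:R^-1 <= k1.+1%:R^-1 :> R by rewrite lef_pV2 ?posrE// ler_nat ltnS.
have gn g : `|ball_fun g (c^-1 *: v) - ball_fun g (u n)| < e / c / 4.
  by rewrite -dualB; apply: le_lt_trans wn; exact: ball_fun_le.
have {fa} := fa (Ordinal nk); have {ha} := ha (Ordinal nk) => /=.
have {gn} := (gn f, gn h) => -[].
move: (ball_fun f _) (ball_fun h _) (ball_fun f _) (ball_fun h _) => f1 h1 f2 h2.
move: (e / c) (k.+1%:R^-1) (k1.+1%:R^-1) kk1 k1P (_ / _ - 1) => d k' k1' kk1 k1P q.
rewrite !ltr_norml => /andP[? ?] /andP[? ?] /andP[? ?] /andP[? ?].
by apply/andP; split; lra.
Qed.

(* Each scale has finitely many boxes, so those of index at least [m] have scale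
   tending to infinity with [m]: this is what makes the enumeration good. *)
Let code := {k : nat & {ffun 'I_k -> 'I_(k.*2.+3)}}.

Definition box_seq m : set (dual_ball E) :=
  if (pickle_inv m : option code) is Some ka then box (tagged ka) else set0.

Lemma box_nbhs f (U : set (dual_ball E)) : nbhs f U ->
  exists k0, forall k, (k0 <= k)%N -> forall a, box (k := k) a f -> box a `<=` U.
Proof.
move=> /ball_nbhs[s [e e0 sU]].
have [k0 k0P] : exists k0, forall k, (k0 <= k)%N -> forall a f h,
    box (k := k) a f -> box a h ->
    forall v, v \in s -> `|ball_fun f v - ball_fun h v| < e.
  elim: s {sU} => [|v s [k1 k1P]]; first by exists 0%N.
  have [k2 k2P] := box_small v e0; exists (maxn k1 k2) => k.
  rewrite geq_max => /andP[kk1 kk2] a g h ga ha w; rewrite inE => /orP[/eqP->|].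
    exact: k2P ha.
  exact: k1P ha w.
by exists k0 => k kk0 a fa h ha; apply: sU; exact: k0P ha.
Qed.

Lemma box_seq_good : good_basis box_seq.
Proof.
split; first split.
- move=> _ [m _ <-]; rewrite /box_seq; case: pickle_inv => [[k a]|].
    exact: box_open.
  exact: open0.
- move=> f U /box_nbhs[k0 k0P]; have [a fa] := box_cover k0 f.
  exists (box a); last exact: (k0P k0 (leqnn _) a fa).
  split=> //; exists (pickle (existT _ k0 a : code)) => //.
  by rewrite /box_seq pickleK_inv.
- move=> U f oU Uf.
  have [k0 k0P] := box_nbhs (open_nbhs_nbhs (conj oU Uf)).
  pose M (k : nat) := \max_(a : {ffun 'I_k -> 'I_(k.*2.+3)})
    pickle (existT _ k a : code).
  exists (\max_(k < k0) M k).+1 => m; rewrite /box_seq.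
  have := @pickle_invK code m; case: pickle_inv => //= -[k a] /= <- Mm fa.
  apply: k0P => //; rewrite leqNgt; apply/negP => kk0.
  have : (M k <= \max_(k < k0) M k)%N by exact: (leq_bigmax (Ordinal kk0)).
  rewrite leqNgt => /negP; apply; apply: (leq_trans Mm).
  exact: (leq_bigmax a).
Qed.

End DualBall.

(** * Restrictions of bidual functionals to the dual ball *)

Section Bidual.
Context (R : realType) (E : normedModType R).
Implicit Types (f : dual_ball E) (g h : bidual_ball_restr E).

Lemma bidual_funP g : exists2 G : dual (dual E),
  `|G| <= 1 & forall f, set_val g f = G (ball_fun f).
Proof. by have [G G1 gG] := set_valP g; exists G => // f; exact: (congr1 (@^~ f) gG). Qed.

Lemma bidual_of_dual (G : dual (dual E)) : `|G| <= 1 ->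
  exists g, forall f, set_val g f = G (ball_fun f).
Proof.
move=> G1; pose g : {ptws dual_ball E -> R} := fun f => G (ball_fun f).
have gP : g \in bidual_ball_restr E by rewrite inE; exists G.
by exists (SigSub gP).
Qed.

Lemma bidual_lipschitz g f f' :
  `|set_val g f - set_val g f'| <= `|ball_fun f - ball_fun f'|.
Proof.
have [G G1 gG] := bidual_funP g; rewrite !gG -dualB.
by apply: (le_trans (dual_norm_bound _ _)); rewrite ler_piMl.
Qed.

Lemma bidual_le1 g f : `|set_val g f| <= 1.
Proof.
have [G G1 gG] := bidual_funP g; rewrite gG.
by apply: (le_trans (dual_norm_bound _ _)); rewrite mulr_ile1// ball_fun_norm.
Qed.

Lemma bidual_ext g h : (forall f, set_val g f = set_val h f) -> g = h.
Proof. by move=> gh; apply: val_inj; apply/funext. Qed.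

Lemma bidual_eval_continuous f : continuous (fun g => set_val g f).
Proof.
move=> g; apply: (@continuous_comp _ {ptws dual_ball E -> R} _
  set_val (fun k : {ptws dual_ball E -> R} => k f)).
  exact: initial_continuous.
exact: proj_continuous.
Qed.

Lemma bidual_dist_continuous g f :
  (fun h => `|set_val g f - set_val h f|) @ g --> `|set_val g f - set_val g f|.
Proof.
apply: (@continuous_comp _ R^o R^o (fun h => set_val h f)
  (fun t => `|set_val g f - t|)); first exact: bidual_eval_continuous.
apply: (@cvg_norm _ R^o); apply: (@cvgB _ R^o); [exact: cvg_cst | exact: cvg_id].
Qed.

Lemma bidual_nbhs g (U : set (bidual_ball_restr E)) : nbhs g U ->
  exists s : seq (dual_ball E), exists2 e, 0 < e &
    forall h, (forall f, f \in s -> `|set_val g f - set_val h f| < e) -> U h.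
Proof.
move=> /subtype_nbhs[B /ptws_nbhs[s [e e0 sB]] BU].
by exists s, e => // h hs; apply: BU; exact: sB.
Qed.

(** Any [G] in the bidual, divided by [|G| + 1], restricts to an element of the set, so the
    hypothesis makes the sequence total in [dual E]. *)
Lemma total_in_ball_separable (T : nat -> dual_ball E) :
  (forall g, (forall n, set_val g (T n) = 0) -> forall f, set_val g f = 0) ->
  separable (dual E).
Proof.
move=> Ttot; apply: (@total_separable R (dual E) (fun n => ball_fun (T n))) => G GT.
have c0 : 0 < `|G| + 1 by rewrite ltr_wpDl.
have cG1 : `|(`|G| + 1)^-1 *: G| <= 1.
  by rewrite normrZ normfV (gtr0_norm c0) ler_pdivrMl// mulr1 lerDl.
have [g gG] := bidual_of_dual cG1.
have g0 : forall f, set_val g f = 0.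
  apply: Ttot => n; rewrite gG.
  by rewrite [LHS](_ : _ = (`|G| + 1)^-1 * G (ball_fun (T n)))// GT mulr0.
apply: dual_norm0_eq0; apply/eqP; rewrite eq_le; apply/andP; split; last first.
  by apply: (le_trans (normr_ge0 (G 0))); apply: dual_norm_ub; rewrite normr0.
apply: dual_norm_le => f0 /ball_funP[f ff0].
have := g0 f; rewrite gG [LHS](_ : _ = (`|G| + 1)^-1 * G (ball_fun f))// ff0.
by move/eqP; rewrite mulf_eq0 invr_eq0 gt_eqF//= => /eqP->; rewrite normr0.
Qed.

(** * A metric for pointwise convergence *)

Section Metric.
Context (u : nat -> dual_ball E).
Hypothesis u_dense :
  forall f (e : R), 0 < e -> exists n, `|ball_fun f - ball_fun (u n)| < e.

(** A weighted supremum in place of the usual weighted series: the [n]-th term is at most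
    [2 / (n + 1)], so finitely many terms decide smallness. *)
Let D g h : set R :=
  range (fun n => `|set_val g (u n) - set_val h (u n)| / n.+1%:R).

Let dist g h := sup (D g h).

Let term_le2 g h n :
  `|set_val g (u n) - set_val h (u n)| / n.+1%:R <= 2 / n.+1%:R.
Proof.
rewrite ler_wpM2r// (le_trans (ler_normB _ _))//.
by have := bidual_le1 g (u n); have := bidual_le1 h (u n); lra.
Qed.

Let dist_has_sup g h : has_sup (D g h).
Proof.
split; first by exists (`|set_val g (u 0) - set_val h (u 0)| / 1); exists 0%N.
exists 2 => _ [n _ <-]; apply: (le_trans (term_le2 g h n)).
by rewrite ler_pdivrMr// ler_peMr// ler1n.
Qed.

Let dist_ub g h n :
  `|set_val g (u n) - set_val h (u n)| / n.+1%:R <= dist g h.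
Proof. by apply: (sup_upper_bound (dist_has_sup g h)); exists n. Qed.

Let dist_le g h a :
  (forall n, `|set_val g (u n) - set_val h (u n)| / n.+1%:R <= a) -> dist g h <= a.
Proof.
move=> ha; apply: ge_sup; first exact: (dist_has_sup g h).1.
by move=> _ [n _ <-].
Qed.

(** The distance controls the value at a nearby [u n], and the 1-Lipschitz property carries the
    control over to [f]. *)
Let dist_control f (e : R) : 0 < e -> exists2 d, 0 < d &
  forall g h, dist g h < d -> `|set_val g f - set_val h f| < e.
Proof.
move=> e0; have e4 : 0 < e / 4 by rewrite divr_gt0.
have [n fn] := u_dense f e4; exists (e / 4 / n.+1%:R); first by rewrite divr_gt0.
move=> g h /(le_lt_trans (dist_ub g h n)); rewrite ltr_pM2r ?invr_gt0// => ghn.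
have gf := le_lt_trans (bidual_lipschitz g f (u n)) fn.
have hf := le_lt_trans (bidual_lipschitz h f (u n)) fn.
move: (set_val g f) (set_val g (u n)) (set_val h f) (set_val h (u n)) gf hf ghn.
move=> a b c d; rewrite !ltr_norml => /andP[? ?] /andP[? ?] /andP[? ?].
by apply/andP; split; lra.
Qed.

Let nbhs_dist g (e : R) : 0 < e -> nbhs g [set h | dist g h < e].
Proof.
move=> e0; have e4 : 0 < e / 4 by rewrite divr_gt0.
(* Terms from [N] on are below [e / 2] by their weight; the first [N] are handled by continuity of
   evaluations. *)
have [N NP] := ltr_add_invr e4; rewrite add0r in NP.
have : \forall h \near g, forall n : 'I_N, `|set_val g (u n) - set_val h (u n)| < e / 2.
  apply: (filter_forall (nbhs_filter g)) => n.
  apply: (cvgr_lt _ (@bidual_dist_continuous g (u n))).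
  by rewrite subrr normr0 divr_gt0.
apply: filterS => h hN /=; apply: (@le_lt_trans _ _ (e / 2)); last by lra.
apply: dist_le => n; have [nN|Nn] := ltnP n N.
  rewrite ler_pdivrMr//; apply: (le_trans (ltW (hN (Ordinal nN)))).
  by rewrite ler_peMr ?ler1n// ltW// divr_gt0.
apply: (le_trans (term_le2 g h n)).
have nN : n.+1%:R^-1 <= N.+1%:R^-1 :> R by rewrite lef_pV2 ?posrE// ler_nat ltnS.
by move: (n.+1%:R^-1) (N.+1%:R^-1) nN NP => a b ? ?; lra.
Qed.

Lemma bidual_metrizable : metrizable R (bidual_ball_restr E).
Proof.
exists dist; split.
- move=> g h; split=> [gh0|->].
    apply: bidual_ext => f; apply/eqP; rewrite -subr_eq0 -normr_le0.
    apply/ler_addgt0Pr => e e0; rewrite add0r.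
    have [d d0 dP] := dist_control f e0.
    by apply/ltW/dP; rewrite gh0.
  apply/eqP; rewrite eq_le; apply/andP; split.
    by apply: dist_le => n; rewrite subrr normr0 mul0r.
  by apply: le_trans (dist_ub h h 0); rewrite subrr normr0 mul0r.
- have le_sym g h : dist g h <= dist h g.
    by apply: dist_le => n; rewrite distrC; exact: dist_ub.
  by move=> g h; apply/eqP; rewrite eq_le !le_sym.
- move=> g h k; apply: dist_le => n.
  apply: le_trans (lerD (dist_ub g h n) (dist_ub h k n)).
  by rewrite -mulrDl ler_wpM2r// ler_distD.
- move=> g U; split=> [/bidual_nbhs[s [e e0 sU]]|[e e0 eU]]; last first.
    exact: filterS eU (nbhs_dist g e0).
  have [d d0 dP] : exists2 d, 0 < d & forall h, dist g h < d ->
      forall f, f \in s -> `|set_val g f - set_val h f| < e.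
    elim: s {sU} => [|f s [d d0 dP]]; first by exists 1.
    have [d' d'0 d'P] := dist_control f e0.
    exists (Num.min d d'); first by rewrite lt_min d0.
    move=> h; rewrite lt_min => /andP[hd hd'] f'; rewrite inE => /orP[/eqP->|].
      exact: d'P.
    exact: dP.
  by exists d => // h /= /dP hs; exact: sU.
Qed.

End Metric.

End Bidual.

(** Interiors of the balls of radius [1 / (i + 1)] are used: they contain [x] since the balls are
    neighbourhoods, and a point of all of them is at distance 0. *)
Lemma metrizable_Gdelta1 (R : realType) (T : topologicalType) (x : T) :
  metrizable R T -> Gdelta [set x].
Proof.
move=> [d [d0 dC dT dN]].
pose B i := [set y | d x y < i.+1%:R^-1].
exists (fun i => (B i)^°%classic); first by move=> i; exact: open_interior.
rewrite eqEsubset; split=> [_ -> i _|y By].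
  by apply/dN; exists i.+1%:R^-1.
apply/esym/d0; apply/eqP; rewrite eq_le; apply/andP; split.
  apply/ler_addgt0Pr => e e0; rewrite add0r.
  have [i iP] := ltr_add_invr e0; rewrite add0r in iP.
  have /interior_subset := By i I.
  by rewrite /B /= => yi; apply/ltW/(lt_trans yi).
by have := dT x y x; rewrite (dC y x) (d0 x x).2//; lra.
Qed.

(** * The implications between the four statements *)

Section Equivalences.
Context (R : realType) (E : normedModType R).

Lemma separable_metrizable :
  separable (dual E) -> metrizable R (bidual_ball_restr E).
Proof.
move=> /separable_ball[u [u1 uP]].
have /choice[v vP] : forall n, exists v : dual_ball E, ball_fun v = u n.
  by move=> n; exact: ball_funP.
apply: (@bidual_metrizable _ _ v) => f e e0.
have [n fn] := uP (ball_fun f) e (ball_fun_norm f) e0.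
by exists n; rewrite vP.
Qed.

Lemma dual_ball0 : exists f : dual_ball E, ball_fun f = 0.
Proof. by apply: ball_funP; rewrite normr0. Qed.

Lemma Gdelta_separable :
  (forall g : bidual_ball_restr E, Gdelta [set g]) -> separable (dual E).
Proof.
have [g0 g0P] : exists g0 : bidual_ball_restr E, forall f, set_val g0 f = 0.
  have [|g gP] := @bidual_of_dual _ E 0; first by rewrite normr0.
  by exists g => f; rewrite gP.
move=> /(_ g0)[F oF Fg0].
have /choice[s sP] : forall i, exists s : seq (dual_ball E), forall h,
    (forall f, f \in s -> set_val h f = 0) -> F i h.
  move=> i; have Fi : F i g0 by have : [set g0] g0 by []; rewrite Fg0; exact.
  have [s [e e0 sF]] := bidual_nbhs (open_nbhs_nbhs (conj (oF i) Fi)).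
  by exists s => h hs; apply: sF => f /hs ->; rewrite g0P subrr normr0.
have [f0 _] := dual_ball0.
(* [T] enumerates the union of the finite sets [s i] through codes of pairs, with [f0] as filler. *)
pose T n := if unpickle n is Some (i, j) then nth f0 (s i) j else f0.
apply: (@total_in_ball_separable _ _ T) => g gT f.
suff -> : g = g0 by exact: g0P.
suff : [set g0] g by [].
rewrite Fg0 => i _; apply: sP => k ks.
by have := gT (pickle (i, index k (s i))); rewrite /T pickleK nth_index.
Qed.

Lemma recovery_range (X : topologicalType) (W : nat -> set X) D x n :
  range D (recovery_seq W D x n).
Proof.
rewrite /recovery_seq; elim: n => [|n IH] /=; first by exists 0%N.
by case: ifP => _; [exact: IH|exists (least_nat (next_indices W D x (history W D x n)))].
Qed.

Lemma recoverable_separable W :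
  uniformly_recoverable W (bidual_ball_restr E) -> separable (dual E).
Proof.
move=> [_ [D _ DP]]; apply: (@total_in_ball_separable _ _ D) => g gD f.
have /(_ f) gf := DP _ (set_valP g).
apply: (@cvg_unique _ (@Rhausdorff R) _ _ _ _ gf).
have -> : (fun n => set_val g (recovery_seq W D f n)) = cst 0.
  by apply/funext => n /=; have [p _ <-] := recovery_range W D f n; rewrite gD.
exact: cvg_cst.
Qed.

(** Vectors [v n] nearly norming a dense sequence [c n] are total: if [f] vanishes on them,
    [|c n| / 2 <= |f - c n|], hence [|f| <= 3 * |f - c n|]. *)
Lemma separable_predual : separable (dual E) -> separable E.
Proof.
move=> /separable_seqP[c cP].
have /choice[v vP] : forall n, exists v : E, `|v| <= 1 /\ `|c n| / 2 <= `|c n v|.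
  move=> n; have [c0|c0] := leP `|c n| 0.
    exists 0; rewrite normr0; split=> //; apply: le_trans (normr_ge0 _).
    by rewrite ler_pdivrMr// mul0r.
  have [|v v1 cv] := @dual_norm_gt _ _ (c n) (`|c n| / 2); first by lra.
  by exists v; split=> //; exact: ltW.
apply: (@total_separable _ _ v) => f fv; apply/eqP; rewrite -normr_le0.
apply/ler_addgt0Pr => e e0; rewrite add0r.
have [|n fn] := cP f (e / 3); first by rewrite divr_gt0.
have [v1 cv] := vP n.
have : `|c n (v n)| <= `|f - c n|.
  have -> : `|c n (v n)| = `|(f - c n) (v n)|.
    by rewrite [(f - c n) _](_ : _ = f (v n) - c n (v n))// fv sub0r normrN.
  apply: (le_trans (dual_norm_bound _ _)).
  by rewrite ler_piMr.
have := ler_normD (f - c n) (c n); rewrite subrK.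
by move: (c n (v n)) cv (f - c n) fn => *; lra.
Qed.

Lemma dual_separable_good_basis : separable (dual E) ->
  exists W : nat -> set (dual_ball E), good_basis W.
Proof.
move=> /separable_predual/separable_ball[u [u1 uP]].
by exists (box_seq u); exact: box_seq_good.
Qed.

(* The rank at scale [k] of a functional is the index of the first ball of
   radius [1 / (k + 1)] around a fixed norm-dense sequence containing it. These
   balls are weak-* closed, so ranks are lower semicontinuous, and a sequence
   whose ranks eventually agree with those of [f] converges to [f] in norm. *)
Lemma separable_recoverable (W : nat -> set (dual_ball E)) :
  good_basis W -> separable (dual E) ->
  uniformly_recoverable W (bidual_ball_restr E).
Proof.
move=> Wgood /separable_seqP[c cP]; split=> //.
have /choice[l lP] : forall kf : nat * dual_ball E, exists j,
    `|ball_fun kf.2 - c j| <= kf.1.+1%:R^-1 /\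
    forall i, (i < j)%N -> kf.1.+1%:R^-1 < `|ball_fun kf.2 - c i|.
  move=> [k f] /=.
  have ex : exists j, `|ball_fun f - c j| <= k.+1%:R^-1.
    have [|j jP] := cP (ball_fun f) k.+1%:R^-1; first by rewrite invr_gt0.
    by exists j; exact: ltW.
  case: (ex_minnP ex) => j jP jmin; exists j; split=> // i ij.
  by rewrite ltNge; apply/negP => /jmin; rewrite leqNgt ij.
have l_lsc k f : \forall h \near f, (l (k, f) <= l (k, h))%N.
  have : \forall h \near f, forall i : 'I_(l (k, f)),
      k.+1%:R^-1 < `|ball_fun h - c i|.
    apply: (filter_forall (nbhs_filter f)) => i; apply: ball_norm_lsc.
    exact: (lP (k, f)).2.
  apply: filterS => h hP; rewrite leqNgt; apply/negP => hf.
  have := hP (Ordinal hf); have := (lP (k, h)).1 => /=.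
  by move=> /le_lt_trans h1 /h1; rewrite ltxx.
have [f0 _] := dual_ball0.
have [D dD DP] := rank_recovery f0 Wgood (@ball_accessible _ E) l_lsc.
exists D => // g Ag f.
have [g' g'E] : exists g' : bidual_ball_restr E, g = set_val g'.
  by exists (SigSub (mem_set Ag)).
rewrite g'E; apply/cvgrPdist_lt => e e0.
have e2 : 0 < e / 2 by rewrite divr_gt0.
have [k kP] := ltr_add_invr e2; rewrite add0r in kP.
apply: filterS (DP f k) => n fn.
apply: (le_lt_trans (bidual_lipschitz g' _ _)).
set f' := recovery_seq W D f n in fn *.
have h1 := (lP (k, f)).1; have h2 := (lP (k, f')).1.
rewrite /= in h1 h2; rewrite fn distrC in h2.
rewrite -(subrK (c (l (k, f))) (ball_fun f)) -addrA.
apply: (le_lt_trans (ler_normD _ _)).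
by move: (k.+1%:R^-1) h1 h2 kP => *; lra.
Qed.

End Equivalences.

Unset Implicit Arguments.

(** [W_fixed] leaves [W] arbitrary when no good basis exists; uniform recoverability is then false,
    as the convention demands. *)
Theorem theorem30 (R : realType) (E : completeNormedModType R)
    (W : nat -> set (dual_ball E))
    (W_fixed : (exists V : nat -> set (dual_ball E), good_basis V) ->
               good_basis W) :
  [<-> separable (dual E);
       metrizable R (bidual_ball_restr E);
       forall g : bidual_ball_restr E, Gdelta [set g];
       uniformly_recoverable W (bidual_ball_restr E)].
Proof.
tfae.
- exact: separable_metrizable.
- by move=> mA g; exact: metrizable_Gdelta1 mA.
- move=> /Gdelta_separable Es; apply: separable_recoverable => //.
  by apply: W_fixed; exact: dual_separable_good_basis.
- exact: recoverable_separable.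
Qed.
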